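(* Let $\alpha=(\alpha_n)_{n\in\mathbb{N}}$ be a sequence with $\alpha_n\uparrow\infty$. The following assertions are equivalent. (i) $\Lambda_0(\alpha)$ is nuclear. (ii) $\lim_{n\to\infty}\frac{\log n}{\alpha_n}=0$. (iii) $\sigma_{pt}(\mathsf{C};\Lambda_0(\alpha))=\Sigma$. (iv) $\sigma_{pt}(\mathsf{C};\Lambda_0(\alpha))\setminus\{1\}\neq\emptyset$.
   Context: Notation: $\mathbb{N}=\{1,2,3,\ldots\}$. The notation $\alpha_n\uparrow\infty$ means that $\alpha=(\alpha_n)_{n\in\mathbb{N}}\subseteq(1,\infty)$ satisfies $\alpha_n<\alpha_{n+1}$ for all $n\in\mathbb{N}$ and $\lim_{n\to\infty}\alpha_n=\infty$. For $k,n\in\mathbb{N}$ put $w_k(n):=e^{-\alpha_n/k}$. The power series space of finite type is $\Lambda_0(\alpha):=\{x\in\mathbb{C}^{\mathbb{N}}\colon \lim_{n\to\infty}w_k(n)|x_n|=0 \text{ for all } k\in\mathbb{N}\}$, a Fréchet space for the topology generated by the increasing sequence of norms $p_k(x):=\sup_{n\in\mathbb{N}}w_k(n)|x_n|$, $k\in\mathbb{N}$. The discrete Cesàro operator is $\mathsf{C}x:=\left(x_1,\frac{x_1+x_2}{2},\ldots,\frac{x_1+\cdots+x_n}{n},\ldots\right)$ for $x\in\mathbb{C}^{\mathbb{N}}$; it maps $\Lambda_0(\alpha)$ continuously into itself. For a continuous linear operator $T$ on a locally convex Hausdorff space $X$, the point spectrum $\sigma_{pt}(T;X)$ is the set of all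 $\lambda\in\mathbb{C}$ such that $\lambda I-T$ is not injective on $X$. Moreover, $\Sigma:=\{\frac1m\colon m\in\mathbb{N}\}$. *)

(* Defs.v *)
From HB Require Import structures.
From mathcomp Require Import all_boot all_order all_algebra.
From mathcomp Require Import all_classical all_reals all_analysis.
From mathcomp Require Import complex lra.

Set Implicit Arguments.
Unset Strict Implicit.
Unset Printing Implicit Defensive.

Import Order.TTheory GRing.Theory Num.Theory.
Import numFieldNormedType.Exports.

Local Open Scope classical_set_scope.
Local Open Scope complex_scope.
Local Open Scope ring_scope.

(* Norms over R[i] take values in R[i]; [rnorm] is the same norm read in R.
   For a scalar z : R[i] it is the modulus of z. *)
Definition rnorm (R : realType) (V : normedZmodType R[i]) (v : V) : R :=
  complex.Re `|v|.

Section rnorm_lemmas.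
Context {R : realType} {V : normedZmodType R[i]}.
Implicit Types v w : V.

Lemma rnormE v : `|v| = (rnorm v)%:C.
Proof.
rewrite /rnorm; have : 0 <= `|v| by [].
by case: `|v| => a b; rewrite lecE /= => /andP[/eqP -> _].
Qed.

Lemma rnorm_ge0 v : 0 <= rnorm v.
Proof. by have := normr_ge0 v; rewrite rnormE ler0c. Qed.

Lemma rnormD v w : rnorm (v + w) <= rnorm v + rnorm w.
Proof. by have := ler_normD v w; rewrite !rnormE -rmorphD /= lecR. Qed.

Lemma rnormN v : rnorm (- v) = rnorm v.
Proof. by rewrite /rnorm normrN. Qed.

Lemma rnorm0 : rnorm (0 : V) = 0.
Proof. by rewrite /rnorm normr0. Qed.

End rnorm_lemmas.

Lemma rnormM (R : realType) (a b : R[i]) : rnorm (a * b) = rnorm a * rnorm b.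
Proof.
by apply: (@complexI R); rewrite rmorphM/= -!rnormE normrM.
Qed.

Lemma rnorm1 (R : realType) : rnorm (1 : R[i]) = 1.
Proof. by rewrite /rnorm normr1. Qed.

Lemma rnorm_real (R : realType) (r : R) : rnorm (r%:C : R[i]) = `|r|.
Proof. by apply: (@complexI R); rewrite -rnormE normc_def/= expr0n/= addr0 sqrtr_sqr. Qed.

Record seminorm (R : realType) (E : lmodType R[i]) := Seminorm {
  seminorm_fun :> E -> R ;
  seminormD : forall x y, seminorm_fun (x + y) <= seminorm_fun x + seminorm_fun y ;
  seminormZ : forall (a : R[i]) x, seminorm_fun (a *: x) = rnorm a * seminorm_fun x
}.

Section seminorm_lemmas.
Context {R : realType} {E : lmodType R[i]} (p : seminorm E).

Lemma seminorm0 : p 0 = 0.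
Proof. by rewrite -(scale0r (0 : E)) seminormZ rnorm0 mul0r. Qed.

Lemma seminormN x : p (- x) = p x.
Proof. by rewrite -scaleN1r seminormZ rnormN rnorm1 mul1r. Qed.

Lemma seminormB x y : p (x - y) <= p x + p y.
Proof. by rewrite (le_trans (seminormD _ _ _))// seminormN. Qed.

Lemma seminormBC x y : p (x - y) = p (y - x).
Proof. by rewrite -seminormN opprB. Qed.

Lemma seminorm_ge0 x : 0 <= p x.
Proof.
have := seminormB x x; rewrite subrr seminorm0 -mulr2n.
by rewrite pmulrn_lge0.
Qed.

Lemma seminorm_dist x y : `|p x - p y| <= p (x - y).
Proof.
rewrite ler_norml lerNl opprB !lerBlDr; apply/andP; split.
  by rewrite seminormBC -{1}(subrK x y) seminormD.
by rewrite -{1}(subrK y x) seminormD.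
Qed.

Lemma seminorm_tri x y z : p (x - z) <= p (x - y) + p (y - z).
Proof. by rewrite -[x in leLHS](subrK y) -addrA seminormD. Qed.

End seminorm_lemmas.

(* The completion of E / ker p, realised as the p-Cauchy sequences of E modulo
   the sequences that tend to 0 for p; the limit of p is its norm. *)
Section local_banach.
Context {R : realType} {E : lmodType R[i]} (p : seminorm E).

Definition seminorm_cauchy : {pred nat -> E} := [pred u | `[<
  forall e : R, 0 < e -> exists N : nat,
    forall m n, (N <= m)%N -> (N <= n)%N -> p (u m - u n) < e >] ].

Lemma seminorm_cauchy_submod_closed : submod_closed seminorm_cauchy.
Proof.
split; first by apply/asboolP => e e0; exists 0%N => m n _ _; rewrite subr0 seminorm0.
move=> a u v /asboolP uc /asboolP vc; apply/asboolP => e e0.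
have a0 : 0 < rnorm a + 1 by rewrite ltr_wpDl ?rnorm_ge0.
have [N1 N1P] := uc (e / 2 / (rnorm a + 1)) ltac:(by rewrite !divr_gt0).
have [N2 N2P] := vc (e / 2) ltac:(by rewrite divr_gt0).
exists (maxn N1 N2) => m n; rewrite !geq_max => /andP[m1 m2] /andP[n1 n2].
rewrite -[(a *: u + v) m]/(a *: u m + v m) -[(a *: u + v) n]/(a *: u n + v n).
rewrite opprD addrACA -scalerBr (le_lt_trans (seminormD _ _ _))//.
rewrite seminormZ (splitr e) ltr_leD ?(ltW (N2P _ _ _ _))//.
rewrite (@le_lt_trans _ _ ((rnorm a + 1) * p (u m - u n)))//.
  by rewrite ler_wpM2r ?seminorm_ge0// lerDl.
by rewrite mulrC -ltr_pdivlMr// N1P.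
Qed.

HB.instance Definition _ :=
  GRing.isSubmodClosed.Build R[i] (nat -> E) seminorm_cauchy
    seminorm_cauchy_submod_closed.

Record cauchy_sequence := CauchySequence {
  cauchy_sequence_val :> nat -> E ;
  _ : cauchy_sequence_val \in seminorm_cauchy }.

HB.instance Definition _ := [isSub for cauchy_sequence_val].
HB.instance Definition _ := [Choice of cauchy_sequence by <:].
HB.instance Definition _ := [SubChoice_isSubLmodule of cauchy_sequence by <:].

Definition null_sequence : {pred cauchy_sequence} := [pred u : cauchy_sequence |
  `[< p \o u @ \oo --> 0 >] ].

Lemma null_sequence_zmod_closed : zmod_closed null_sequence.
Proof.
split.
  apply/asboolP; rewrite (_ : _ \o _ = cst 0); first exact: cvg_cst.
  by apply/funext => n /=; rewrite seminorm0.
move=> u v /asboolP u0 /asboolP v0; apply/asboolP.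
apply: (@squeeze_cvgr _ _ _ _ (cst 0) ((p \o u) \+ (p \o v))).
- near=> n; rewrite seminorm_ge0/=.
  exact: seminormB.
- exact: cvg_cst.
- by rewrite -(addr0 0); apply: cvgD.
Unshelve. all: by end_near. Qed.

HB.instance Definition _ :=
  GRing.isZmodClosed.Build cauchy_sequence null_sequence
    null_sequence_zmod_closed.

Definition local_banach := Quotient.quot null_sequence.

HB.instance Definition _ := GRing.Zmodule.on local_banach.
HB.instance Definition _ := EqQuotient.on local_banach.

Local Notation cls u := (\pi_local_banach%qT (u : cauchy_sequence)).

Lemma local_banachP (u v : cauchy_sequence) :
  cls u = cls v <-> (fun n => p (u n - v n)) @ \oo --> (0 : R).
Proof.
split => [/eqP|uv]; last apply/eqP.
  by rewrite -Quotient.idealrBE => /asboolP.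
by rewrite -Quotient.idealrBE; apply/asboolP.
Qed.

Let reprE (u : cauchy_sequence) :
  (fun n => p (repr (cls u) n - u n)) @ \oo --> (0 : R).
Proof. by apply/local_banachP; rewrite reprK. Qed.

Let scale (a : R[i]) (x : local_banach) : local_banach := cls (a *: repr x).

Let clsZ a u : cls (a *: u) = scale a (cls u).
Proof.
apply/local_banachP.
rewrite (_ : (fun _ => _) = (fun n => rnorm a * p (repr (cls u) n - u n))).
  by rewrite -(mulr0 (rnorm a)); apply: cvgMr; exact: reprE.
apply/funext => n.
rewrite -[(a *: u) n]/(a *: u n) -[(a *: repr (cls u)) n]/(a *: repr (cls u) n).
by rewrite -scalerBr seminormZ seminormBC.
Qed.

Let scaleA a b x : scale a (scale b x) = scale (a * b) x.
Proof. by rewrite [scale b x]/scale -clsZ scalerA. Qed.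

Let scale1 x : scale 1 x = x.
Proof. by rewrite /scale scale1r reprK. Qed.

Let clsD u v : cls (u + v) = cls u + cls v.
Proof. by rewrite piE. Qed.

Let scaleDr : right_distributive scale +%R.
Proof.
by move=> a x y; rewrite -[x]reprK -[y]reprK -clsD -!clsZ scalerDr clsD.
Qed.

Let scaleDl x : {morph scale^~ x : a b / a + b}.
Proof. by move=> a b /=; rewrite -[x]reprK -!clsZ scalerDl clsD. Qed.

HB.instance Definition _ := GRing.Zmodule_isLmodule.Build R[i] local_banach
  scaleA scale1 scaleDr scaleDl.

Lemma local_banach_pi_linear : linear (\pi_local_banach%qT : cauchy_sequence -> _).
Proof. by move=> a u v; rewrite clsD clsZ. Qed.

Let cauchy_sequence_cvg (u : cauchy_sequence) : cvgn (p \o u).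
Proof.
apply/cauchy_cvgP/cauchy_exP => e e0.
case: u => u /= /asboolP/(_ e e0) [N NP].
exists (p (u N)); exists N => // n /= Nn.
by rewrite -ball_normE/= (le_lt_trans (seminorm_dist _ _ _))// NP.
Qed.

Let norm (x : local_banach) : R[i] := (limn (p \o repr x))%:C.

Let norm_cls u : norm (cls u) = (limn (p \o u))%:C.
Proof.
rewrite /norm; congr (_%:C); apply: cvg_lim => //.
rewrite -[X in _ --> X]addr0.
rewrite (_ : _ \o _ = (p \o u) \+ (p \o repr (cls u) \- (p \o u))); last first.
  by apply/funext => n /=; rewrite addrC subrK.
apply: cvgD; first exact: cauchy_sequence_cvg.
apply/norm_cvg0P.
apply: (@squeeze_cvgr _ _ _ _ (cst 0) (fun n => p (repr (cls u) n - u n))).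
- by near=> n; rewrite normr_ge0 seminorm_dist.
- exact: cvg_cst.
- exact: reprE.
Unshelve. all: by end_near. Qed.

Let ler_normD x y : norm (x + y) <= norm x + norm y.
Proof.
rewrite -[x]reprK -[y]reprK -clsD !norm_cls -rmorphD /= lecR.
have cu : cvgn (p \o repr x) by exact: cauchy_sequence_cvg.
have cv : cvgn (p \o repr y) by exact: cauchy_sequence_cvg.
have cuv : cvgn (p \o (repr x + repr y)) by exact: cauchy_sequence_cvg.
apply: (ler_cvg_to cuv (cvgD cu cv)).
by near=> n; exact: seminormD.
Unshelve. all: by end_near. Qed.

Let normrZ a x : norm (a *: x) = `|a| * norm x.
Proof.
rewrite -[x]reprK -[LHS]/(norm (scale a _)) -clsZ !norm_cls rnormE -rmorphM /=.
congr (_%:C); apply: cvg_lim => //.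
rewrite (_ : _ \o _ = (fun n => rnorm a * p (repr x n))).
  by apply: cvgMr; exact: cauchy_sequence_cvg.
by apply/funext => n /=; rewrite -seminormZ.
Qed.

Let normr0_eq0 x : norm x = 0 -> x = 0.
Proof.
rewrite -[x]reprK norm_cls => /(@complexI R) x0.
have <- : cls 0 = 0 by apply: (addrI (cls 0)); rewrite -clsD !addr0.
apply/local_banachP; rewrite -[in X in _ --> X]x0.
rewrite (_ : (fun _ => _) = p \o repr x); first exact: cauchy_sequence_cvg.
by apply/funext => n /=; rewrite subr0.
Qed.

HB.instance Definition _ := Lmodule_isNormed.Build R[i] local_banach
  ler_normD normrZ normr0_eq0.

Lemma local_banach_norm (u : cauchy_sequence) : p \o u @ \oo --> rnorm (cls u).
Proof.
rewrite (_ : rnorm _ = limn (p \o u)); first exact: cauchy_sequence_cvg.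
by apply: (@complexI R); rewrite -rnormE -norm_cls.
Qed.

Arguments local_banach_norm : clear implicits.

Lemma constant_cauchy x : cst x \in seminorm_cauchy.
Proof.
by apply/asboolP => e e0; exists 0%N => m n _ _; rewrite subrr seminorm0.
Qed.

Definition to_local_banach (x : E) : local_banach :=
  cls (CauchySequence (constant_cauchy x)).

Lemma to_local_banach_linear : linear to_local_banach.
Proof.
move=> a x y; rewrite -local_banach_pi_linear; congr (cls _).
exact: val_inj.
Qed.

HB.instance Definition _ := GRing.isLinear.Build R[i] E local_banach *:%R
  to_local_banach to_local_banach_linear.

Lemma to_local_banach_norm x : rnorm (to_local_banach x) = p x.
Proof.
have := local_banach_norm (CauchySequence (constant_cauchy x)).
move=> /(cvg_lim (@Rhausdorff R)) <-.
by rewrite (_ : p \o _ = cst (p x))// lim_cst.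
Qed.

Lemma to_local_banach_approx (u : cauchy_sequence) n e :
  (forall m, (n <= m)%N -> p (u m - u n) <= e) ->
  rnorm (cls u - to_local_banach (u n)) <= e.
Proof.
move=> une; rewrite /to_local_banach.
set c := CauchySequence _.
have -> : cls u - cls c = cls (u - c) by apply: (addIr (cls c)); rewrite -clsD !subrK.
have uc := local_banach_norm (u - c).
rewrite -(cvg_lim (@Rhausdorff R) uc); apply: limr_le; first by apply/cvg_ex; exists (rnorm (cls (u - c))).
by exists n => // m /= nm; exact: une.
Qed.

Lemma to_local_banach_dense (x : local_banach) (e : R) : 0 < e ->
  exists y : E, rnorm (x - to_local_banach y) < e.
Proof.
move=> e0; rewrite -[x]reprK; have /asboolP := valP (repr x).
move=> /(_ (e / 2) ltac:(by rewrite divr_gt0)) [N NP].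
exists (repr x N); rewrite (@le_lt_trans _ _ (e / 2))//; last first.
  by rewrite ltr_pdivrMr// ltr_pMr// ltr1n.
by apply: to_local_banach_approx => m Nm; rewrite ltW// NP.
Qed.

Let local_banach_ball (x y : local_banach) (e : R) :
  ball x e%:C y <-> rnorm (x - y) < e.
Proof. by rewrite -ball_normE /= rnormE ltcR. Qed.

Let local_banach_complete (F : set_system local_banach) :
  ProperFilter F -> cauchy F -> cvg F.
Proof.
move=> FF /cauchyP Fc.
have gt0 n : 0 < n.+1%:R^-1 :> R by [].
have /choice[y Fy] n : exists y : local_banach, F (ball y (n.+1%:R^-1)%:C).
  by apply: Fc; rewrite (@ltcR R 0).
have /choice[z yz] n := to_local_banach_dense (y n) (gt0 n).
have zF n : F [set x | rnorm (x - to_local_banach (z n)) < 2 * n.+1%:R^-1].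
  apply: filterS (Fy n) => x /local_banach_ball yx /=.
  rewrite mulr2n mulrDl !mul1r -[x in X in X < _](subrK (y n)) -addrA.
  by rewrite (le_lt_trans (rnormD _ _))// ltrD// -rnormN opprB.
have zz m n : p (z m - z n) < 2 * m.+1%:R^-1 + 2 * n.+1%:R^-1.
  have [x /= []] := filter_ex (filterI (zF m) (zF n)).
  move=> xm xn; rewrite -to_local_banach_norm linearB/=.
  rewrite -[to_local_banach (z m)](subrK x) -addrA.
  by rewrite (le_lt_trans (rnormD _ _))// ltrD// -rnormN opprB.
have small (e : R) : 0 < e -> exists N : nat, forall n, (N <= n)%N ->
    2 * n.+1%:R^-1 < e.
  move=> e0; have [N _ NP] := near_infty_natSinv_lt (PosNum (divr_gt0 e0 (ltr0Sn R 1))).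
  by exists N => n /NP /=; rewrite ltr_pdivlMr// mulrC.
have zc : z \in seminorm_cauchy.
  apply/asboolP => e e0.
  have [N NP] := small (e / 2) (divr_gt0 e0 (ltr0Sn R 1)); exists N => m n Nm Nn.
  by rewrite (lt_trans (zz _ _))// (splitr e) ltrD// NP.
apply/cvg_ex; exists (cls (CauchySequence zc)); apply/cvgrPdist_lt => e' e'0.
have [e ee' e0] : exists2 e : R, e' = e%:C & 0 < e.
  move: e'0; case: e' => a b; rewrite ltcE /= => /andP[/eqP -> a0].
  by exists a.
have [N NP] := small (e / 4) (divr_gt0 e0 (ltr0Sn R 3)).
apply: filterS (zF N) => x /= xN.
rewrite ee' rnormE ltcR -[cls _](subrK (to_local_banach (z N))) -addrA.
rewrite (le_lt_trans (rnormD _ _))//.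
have e4 : e / 4 + e / 4 = e / 2 by lra.
rewrite [ltRHS]splitr ler_ltD//.
  apply: to_local_banach_approx => m Nm.
  by rewrite (le_trans (ltW (zz _ _)))// -e4 lerD// ltW// NP.
rewrite -rnormN opprB (lt_trans xN)// (lt_trans (NP N _))//.
by rewrite ltr_pM2l// ltf_pV2 ?posrE// ltr_nat.
Qed.

HB.instance Definition _ := Uniform_isComplete.Build local_banach
  local_banach_complete.

End local_banach.

(* The operator norm of a continuous linear functional. *)
Definition dual_norm (R : realType) (F : normedModType R[i])
    (f : {linear F -> R[i]^o}) : R :=
  sup [set rnorm (f x) | x in [set x : F | rnorm x <= 1]].

Definition nuclear_operator (R : realType) (F G : normedModType R[i])
    (T : {linear F -> G}) : Prop :=
  exists (f : nat -> {linear F -> R[i]^o}) (y : nat -> G),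
    [/\ forall n, continuous (f n),
        cvgn (series (fun n => dual_norm (f n) * rnorm (y n))) &
        forall x, series (fun n => f n x *: y n) @ \oo --> T x].

(* T is the canonical map of local Banach spaces induced by the identity of E
   when p <= q. *)
Definition canonical_map (R : realType) (E : lmodType R[i]) (p q : seminorm E)
    (T : {linear local_banach q -> local_banach p}) : Prop :=
  continuous T /\ forall x : E, T (to_local_banach q x) = to_local_banach p x.

Definition nuclear_space (R : realType) (E : tvsType R[i]) : Prop :=
  forall p : seminorm E, continuous p ->
    exists q : seminorm E, [/\ continuous q, forall x, p x <= q x &
      exists2 T : {linear local_banach q -> local_banach p},
        canonical_map T & nuclear_operator T].

(* [seminormed p] is E with the locally convex topology generated by the
   seminorms p 0, p 1, p 2, etc. *)
Definition seminormed (R : realType) (E : lmodType R[i])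
  (p : nat -> seminorm E) : Type := E.

Section seminormed.
Context {R : realType} {E : lmodType R[i]} (p : nat -> seminorm E).

HB.instance Definition _ := GRing.Lmodule.on (seminormed p).

Definition seminorm_ball (x : seminormed p) (N : nat) (e : R) :
    set (seminormed p) :=
  [set y | forall k, (k <= N)%N -> p k (y - x) < e].

Definition seminorm_nbhs (x : seminormed p) : set_system (seminormed p) :=
  [set A | exists (N : nat) (e : R), 0 < e /\ seminorm_ball x N e `<=` A].

HB.instance Definition _ := hasNbhs.Build (seminormed p) seminorm_nbhs.

Let nbhs_ball (x : seminormed p) N e : 0 < e -> nbhs x (seminorm_ball x N e).
Proof. by move=> e0; exists N, e; split. Qed.

Let nbhs_filter (x : seminormed p) : ProperFilter (nbhs x).
Proof.
split.
  move=> [N [e [e0 eA]]]; apply: (eA x) => k _.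
  by rewrite subrr seminorm0.
split.
- by exists 0%N, 1; split.
- move=> A B [N [e [e0 eA]]] [M [d [d0 dB]]].
  exists (maxn N M), (Num.min e d); split; first by rewrite lt_min e0.
  move=> y yb; split.
    apply: eA => k kN; apply: (lt_le_trans (yb k _)); last by rewrite ge_min lexx.
    by rewrite leq_max kN.
  apply: dB => k kM; apply: (lt_le_trans (yb k _)).
    by rewrite leq_max kM orbT.
  by rewrite ge_min lexx orbT.
- by move=> A B AB [N [e [e0 eA]]]; exists N, e; split => // y /eA /AB.
Qed.

Let nbhs_singleton (x : seminormed p) (A : set (seminormed p)) :
  nbhs x A -> A x.
Proof.
by move=> [N [e [e0 eA]]]; apply: eA => k _; rewrite subrr seminorm0.
Qed.

Let ball_nbhs (x y : seminormed p) N e :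
  seminorm_ball x N e y -> nbhs y (seminorm_ball x N e).
Proof.
move=> xy.
have [d d0 dP] : exists2 d : R, 0 < d &
    forall k, (k <= N)%N -> p k (y - x) + d <= e.
  elim: N xy => [xy|N IH xy].
    exists (e - p 0%N (y - x)); first by rewrite subr_gt0 xy.
    by move=> k; rewrite leqn0 => /eqP ->; rewrite subrKC.
  have [k kN|d d0 dP] := IH; first by apply: xy; rewrite ltnW.
  exists (Num.min d (e - p N.+1 (y - x))).
    by rewrite lt_min d0 subr_gt0 xy.
  move=> k; rewrite leq_eqVlt => /predU1P[->|kN].
    by rewrite -lerBrDl ge_min lexx orbT.
  by rewrite -lerBrDl ge_min lerBrDl dP.
exists N, d; split => // z yz k kN.
rewrite (lt_le_trans _ (dP k kN))//.
apply: (le_lt_trans (seminorm_tri (p k) z y x)).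
by rewrite addrC ltrD2l; exact: yz.
Qed.

Let nbhs_nbhs (x : seminormed p) (A : set (seminormed p)) :
  nbhs x A -> nbhs x (nbhs^~ A).
Proof.
move=> [N [e [e0 eA]]]; exists N, e; split => // y xy.
have [M [d [d0 dP]]] := ball_nbhs xy; exists M, d; split => //.
exact: (subset_trans dP).
Qed.

HB.instance Definition _ := Nbhs_isNbhsTopological.Build (seminormed p)
  nbhs_filter nbhs_singleton nbhs_nbhs.

Let add_continuous :
  continuous (fun x : seminormed p * seminormed p => x.1 + x.2).
Proof.
move=> [x y] A [N [e [e0 eA]]] /=.
have e20 : 0 < e / 2 by rewrite divr_gt0.
exists (seminorm_ball x N (e / 2), seminorm_ball y N (e / 2)).
  by split; exact: nbhs_ball.
move=> [a b] [/= ax yb]; apply: eA => k kN.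
rewrite opprD addrACA; apply: (le_lt_trans (seminormD (p k) _ _)).
by rewrite [ltRHS]splitr ltrD//; [exact: ax|exact: yb].
Qed.

Let scale_continuous :
  continuous (fun z : R[i]^o * seminormed p => z.1 *: z.2).
Proof.
move=> [a x] A [N [e [e0 eA]]] /=.
have [M M0 MP] : exists2 M : R, 0 < M & forall k, (k <= N)%N -> p k x <= M.
  exists (1 + \sum_(k < N.+1) p k x).
    by rewrite ltr_pwDl// sumr_ge0// => k _; exact: seminorm_ge0.
  move=> k; rewrite -ltnS => kN; rewrite (bigD1 (Ordinal kN))//= addrCA lerDl.
  by rewrite addr_ge0// sumr_ge0// => j _; exact: seminorm_ge0.
pose d := Num.min 1 (e / 2 / M).
have d0 : 0 < d by rewrite lt_min ltr01 !divr_gt0.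
have a0 : 0 < rnorm a + 1 by rewrite ltr_wpDl ?rnorm_ge0.
exists (ball (a : R[i]^o) d%:C, seminorm_ball x N (e / 2 / (rnorm a + 1))).
  split; last by apply: nbhs_ball; rewrite !divr_gt0.
  by apply: nbhsx_ballx; rewrite (@ltcR R 0).
move=> [b y] [/= ab xy]; apply: eA => k kN /=.
move: ab; rewrite -ball_normE/= rnormE ltcR lt_min => /andP[ab1 abM].
rewrite -(subrK (b *: x) (b *: y)) -scalerBr -addrA -scalerBl.
rewrite (le_lt_trans (seminormD _ _ _))// !seminormZ (splitr e) ltr_leD//.
  rewrite (@le_lt_trans _ _ ((rnorm a + 1) * p k (y - x)))//.
    rewrite ler_wpM2r ?seminorm_ge0// -(subrK a b).
    by rewrite addrC (le_trans (rnormD _ _))// lerD2l -rnormN opprB ltW.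
  by rewrite mulrC -ltr_pdivlMr// xy.
rewrite -rnormN opprB (@le_trans _ _ (rnorm (a - b) * M))//.
  by rewrite ler_wpM2l ?rnorm_ge0// MP.
by rewrite -ler_pdivlMr// ltW.
Qed.

Let locally_convex : exists2 B : set_system (seminormed p),
  (forall b, b \in B -> convex_set b) & basis B.
Proof.
exists [set B | exists x N e, B = seminorm_ball x N e].
  move=> _ /[!inE] -[x [N [e ->]]]; apply/convex_setW.
  move=> y z /[!inE] xy xz l l0 l1; rewrite inE => k kN.
  have ln : rnorm l%:num + rnorm (1 - l%:num) = 1 :> R.
    apply: (@complexI R); rewrite rmorphD/= -!rnormE.
    by rewrite !ger0_norm ?subr_ge0 ?(ltW l0) ?(ltW l1)// addrC subrK.
  have -> : conv l y z - x = l%:num *: (y - x) + (1 - l%:num) *: (z - x).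
    rewrite !scalerBr addrACA -opprD -scalerDl.
    by rewrite [l%:num + _]addrC subrK scale1r.
  rewrite (le_lt_trans (seminormD _ _ _))// !seminormZ.
  have a0 : 0 < rnorm l%:num.
    by rewrite -(@ltcR R 0) -rnormE normr_gt0 gt_eqF.
  rewrite -[ltRHS]mul1r -ln mulrDl ltr_leD ?ltr_pM2l//.
    exact: xy.
  by rewrite ler_wpM2l ?rnorm_ge0// ltW//; exact: xz.
split.
  by move=> _ [x [N [e ->]]]; rewrite openE => y; exact: ball_nbhs.
move=> x A [N [e [e0 eA]]]; exists (seminorm_ball x N e) => //=.
split; first by exists x, N, e.
by move=> k _; rewrite subrr seminorm0.
Qed.

HB.instance Definition _ := PreTopologicalLmod_isTvs.Build R[i] (seminormed p)
  add_continuous scale_continuous locally_convex.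
HB.instance Definition _ :=
  PreTopologicalNmodule_isTopologicalNmodule.Build (seminormed p) add_continuous.
HB.instance Definition _ :=
  TopologicalNmodule_isTopologicalLmodule.Build R[i] (seminormed p)
    scale_continuous.
HB.instance Definition _ :=
  Uniform_isTvs.Build R[i] (seminormed p) locally_convex.

End seminormed.

Section power_series_space.
Context {R : realType} (alpha : nat -> R).

(* Sequences are indexed from 0: [alpha n], [x n] are the alpha_{n+1}, x_{n+1}
   of the usual notation, and [weight k n] is w_{k+1}(n+1). *)
Definition weight (k n : nat) : R := expR (- (alpha n / k.+1%:R)).

Definition Lambda0_pred : {pred nat -> R[i]} := [pred x : nat -> R[i] |
  `[< forall k, (fun n => weight k n * rnorm (x n)) @ \oo --> (0 : R) >] ].

Lemma Lambda0_submod_closed : submod_closed Lambda0_pred.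
Proof.
split.
  apply/asboolP => k.
  rewrite (_ : (fun _ => _) = cst 0); first exact: cvg_cst.
  by apply/funext => n; rewrite rnorm0 mulr0.
move=> a x y /asboolP xL /asboolP yL; apply/asboolP => k.
apply: (@squeeze_cvgr _ _ _ _ (cst 0) (fun n =>
  rnorm a * (weight k n * rnorm (x n)) + weight k n * rnorm (y n))).
- near=> n; rewrite mulr_ge0 ?rnorm_ge0 ?expR_ge0//=.
  rewrite mulrCA -mulrDr ler_wpM2l ?expR_ge0// -rnormM.
  exact: rnormD.
- exact: cvg_cst.
- rewrite -[X in _ --> X](addr0 (0 : R)) -[X in _ --> X + _](mulr0 (rnorm a)).
  by apply: cvgD; [apply: cvgMr; exact: xL|exact: yL].
Unshelve. all: by end_near. Qed.

HB.instance Definition _ :=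
  GRing.isSubmodClosed.Build R[i] (nat -> R[i]) Lambda0_pred
    Lambda0_submod_closed.

Record Lambda0_seq := MkLambda0_seq {
  Lambda0_val :> nat -> R[i] ;
  _ : Lambda0_val \in Lambda0_pred }.

HB.instance Definition _ := [isSub for Lambda0_val].
HB.instance Definition _ := [Choice of Lambda0_seq by <:].
HB.instance Definition _ := [SubChoice_isSubLmodule of Lambda0_seq by <:].

Definition Lambda0_norm (k : nat) (x : Lambda0_seq) : R :=
  sup (range (fun n => weight k n * rnorm (x n))).

Lemma Lambda0_norm_ub k (x : Lambda0_seq) n :
  weight k n * rnorm (x n) <= Lambda0_norm k x.
Proof.
apply: ub_le_sup; last by exists n.
have /asboolP/(_ k) xk := valP x.
have [M [_ MP]] := cvg_seq_bounded (cvgP _ xk).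
exists (M + 1) => _ [m _ <-].
by rewrite (le_trans (ler_norm _))//; apply: MP => //; rewrite ltrDl.
Qed.

Lemma Lambda0_norm_le k (x : Lambda0_seq) M :
  (forall n, weight k n * rnorm (x n) <= M) -> Lambda0_norm k x <= M.
Proof.
move=> xM; apply: ge_sup; first by exists (weight k 0 * rnorm (x 0)); exists 0%N.
by move=> _ [n _ <-].
Qed.

Let Lambda0_normD k x y :
  Lambda0_norm k (x + y) <= Lambda0_norm k x + Lambda0_norm k y.
Proof.
apply: Lambda0_norm_le => n.
rewrite (le_trans _ (lerD (Lambda0_norm_ub k x n) (Lambda0_norm_ub k y n)))//.
by rewrite -mulrDr ler_wpM2l ?expR_ge0// rnormD.
Qed.

Let Lambda0_normZ k (a : R[i]) x :
  Lambda0_norm k (a *: x) = rnorm a * Lambda0_norm k x.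
Proof.
apply/eqP; rewrite eq_le; apply/andP; split.
  apply: Lambda0_norm_le => n.
  rewrite rnormM mulrCA ler_wpM2l ?rnorm_ge0//.
  exact: Lambda0_norm_ub.
have [->|a0] := eqVneq a 0.
  rewrite rnorm0 mul0r (le_trans _ (Lambda0_norm_ub k _ 0))//.
  by rewrite mulr_ge0 ?expR_ge0 ?rnorm_ge0.
have ra : 0 < rnorm a by rewrite -(@ltcR R 0) -rnormE normr_gt0.
rewrite mulrC -ler_pdivlMr//; apply: Lambda0_norm_le => n.
rewrite ler_pdivlMr// -mulrA [_ * rnorm a]mulrC -rnormM.
exact: (Lambda0_norm_ub k (a *: x)).
Qed.

Definition Lambda0_seminorm (k : nat) : seminorm Lambda0_seq :=
  Seminorm (Lambda0_normD k) (Lambda0_normZ k).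

Definition Lambda0 : tvsType R[i] := seminormed Lambda0_seminorm.

End power_series_space.

Definition increases_to_infinity (R : realType) (alpha : nat -> R) : Prop :=
  [/\ forall n, 1 < alpha n,
      forall n, alpha n < alpha n.+1 &
      alpha @ \oo --> +oo].

Definition cesaro_seq (R : realType) (x : nat -> R[i]) : nat -> R[i] :=
  fun n => (\sum_(i < n.+1) x i) / n.+1%:R.

Section cesaro.
Context {R : realType} (alpha : nat -> R).
Hypothesis alphaP : increases_to_infinity alpha.

Let weight_le k m n : (m <= n)%N -> weight alpha k n <= weight alpha k m.
Proof.
case: alphaP => _ inc _ mn; rewrite ler_expR lerN2 ler_pM2r ?invr_gt0//.
by have /nondecreasing_seqP := fun n => ltW (inc n); exact.
Qed.

Lemma cesaro_Lambda0 (x : Lambda0 alpha) :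
  cesaro_seq (Lambda0_val x) \in Lambda0_pred alpha.
Proof.
apply/asboolP => k; have /asboolP/(_ k) xk := valP (x : Lambda0_seq alpha).
apply: (@squeeze_cvgr _ _ _ _ (cst 0)
  (arithmetic_mean (fun n => weight alpha k n * rnorm (Lambda0_val x n)))).
- near=> n; rewrite mulr_ge0 ?rnorm_ge0 ?expR_ge0//=.
  have -> : rnorm (cesaro_seq (Lambda0_val x) n) =
      n.+1%:R^-1 * rnorm (\sum_(i < n.+1) Lambda0_val x i).
    rewrite rnormM mulrC -(rmorph_nat (real_complex R)) -fmorphV rnorm_real.
    by rewrite ger0_norm.
  rewrite mulrCA ler_pM2l ?invr_gt0// seriesEord /=.
  have rsum : rnorm (\sum_(i < n.+1) Lambda0_val x i) <=
      \sum_(i < n.+1) rnorm (Lambda0_val x i).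
    elim/big_rec2 : _ => [|i u v _ uv]; first by rewrite rnorm0.
    by rewrite (le_trans (rnormD _ _))// lerD2l.
  rewrite (le_trans (ler_wpM2l (expR_ge0 _) rsum))// big_distrr/=.
  by apply: ler_sum => i _; rewrite ler_wpM2r ?rnorm_ge0// weight_le// -ltnS.
- exact: cvg_cst.
- exact: cesaro.
Unshelve. all: by end_near. Qed.

Definition cesaro_op (x : Lambda0 alpha) : Lambda0 alpha :=
  MkLambda0_seq (cesaro_Lambda0 x).

Lemma cesaro_op_linear : linear cesaro_op.
Proof.
move=> a x y; apply: val_inj; apply/funext => n /=.
rewrite -[RHS]/(a *: (cesaro_seq x n) + cesaro_seq y n).
rewrite /cesaro_seq -[RHS]/(a * (_ / _) + _) mulrA -mulrDl mulr_sumr -big_split/=.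
by [].
Qed.

HB.instance Definition _ := GRing.isLinear.Build R[i] (Lambda0 alpha)
  (Lambda0 alpha) *:%R cesaro_op cesaro_op_linear.

End cesaro.

Definition point_spectrum (R : realType) (X : lmodType R[i])
    (T : {linear X -> X}) : set R[i] :=
  [set l | ~ injective (fun x : X => l *: x - T x)].

Definition Sigma (R : realType) : set R[i] :=
  [set z | exists m : nat, (0 < m)%N /\ z = m%:R^-1].
Arguments Sigma : clear implicits.

(* Main.v *)
From HB Require Import structures.
Require Import Defs.
From mathcomp Require Import all_boot all_order all_algebra.
From mathcomp Require Import all_classical all_reals all_analysis.
From mathcomp Require Import complex ring.

Set Implicit Arguments.
Unset Strict Implicit.
Unset Printing Implicit Defensive.

Import Order.TTheory GRing.Theory Num.Theory.
Import numFieldNormedType.Exports.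

Local Open Scope classical_set_scope.
Local Open Scope complex_scope.
Local Open Scope ring_scope.

(** Everything is controlled by the decay of the weights
    w_k(n) = exp (- alpha_n / (k + 1)). If (n + 1) w_k(n) is bounded in n for
    each k, then ln (n + 1) / alpha_n tends to 0 ([log_negligible]); and if
    this quotient tends to 0, then n^m w_k(n) tends to 0 for all k and m
    ([power_weight_cvg0]).

    Nuclearity makes the weights summable, by a trace argument: the canonical
    map between local Banach spaces fixes every unit vector, so all its
    diagonal entries are 1, while a nuclear representation bounds the weighted
    sum of these entries ([nuclear_weight_sum_le]). As the weights decrease
    with n, this gives the first growth condition ([nuclear_weight_growth]).
    Conversely, rapid decay makes the expansion along unit vectors and
    coordinate functionals a nuclear representation of the canonical maps
    ([log_nuclear]).

    On the spectral side, the eigenvalue equation of the Cesaro operator is a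
    two-term recurrence. It forces the eigenvalue to be 1 / m, where m - 1 is
    the index of the first nonzero entry ([cesaro_eigenvalue]), and the
    eigenvectors are then the multiples of n |-> 'C(n, m - 1). Rapid decay of
    the weights puts all these sequences in the space
    ([cesaro_point_spectrum]). Conversely, an eigenvector for m > 1 grows at
    least linearly, so its presence in the space gives the growth condition
    ([point_spectrum_weight_growth]) and hence the logarithmic one. *)

(** * Moduli and norms read in R *)

Lemma rnorm_eq0 (R : realType) (V : normedZmodType R[i]) (v : V) :
  (rnorm v == 0) = (v == 0).
Proof.
by rewrite -[RHS]normr_eq0 rnormE -[0 : R[i]]/(0%:C) (inj_eq (@complexI R)).
Qed.

Lemma rnormBC (R : realType) (V : normedZmodType R[i]) (v w : V) :
  rnorm (v - w) = rnorm (w - v).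
Proof. by rewrite -rnormN opprB. Qed.

Lemma rnormZ (R : realType) (V : normedModType R[i]) (a : R[i]) (v : V) :
  rnorm (a *: v) = rnorm a * rnorm v.
Proof. by apply: (@complexI R); rewrite rmorphM/= -!rnormE normrZ. Qed.

Lemma rnorm_sum (R : realType) (V : normedZmodType R[i]) (I : Type) (r : seq I)
    (P : pred I) (F : I -> V) :
  rnorm (\sum_(i <- r | P i) F i) <= \sum_(i <- r | P i) rnorm (F i).
Proof.
elim/big_rec2 : _ => [|i u v _ uv]; first by rewrite rnorm0.
by rewrite (le_trans (rnormD _ _))// lerD2l.
Qed.

Lemma rnorm_natr (R : realType) (n : nat) : rnorm (n%:R : R[i]) = n%:R.
Proof.
by rewrite -(rmorph_nat (real_complex R)) rnorm_real ger0_norm.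
Qed.

Lemma gt0_complexP (R : realType) (e : R[i]) : 0 < e ->
  exists2 d : R, 0 < d & e = d%:C.
Proof.
by case: e => a b; rewrite ltcE /= => /andP[/eqP -> a0]; exists a.
Qed.

Lemma cvg_rnormP (R : realType) (V : normedModType R[i]) (u : nat -> V) (l : V) :
  u @ \oo --> l <-> (fun n => rnorm (u n - l)) @ \oo --> (0 : R).
Proof.
split=> [/cvgrPdist_lt ul|/cvgrPdist_lt ul]; apply/cvgrPdist_lt => e e0.
  have := ul e%:C; rewrite (@ltcR R 0) => /(_ e0).
  apply: filterS => n; rewrite rnormE ltcR sub0r normrN ger0_norm ?rnorm_ge0//.
  by rewrite rnormBC.
have [d d0 ->] := gt0_complexP e0.
apply: filterS (ul d d0) => n.
by rewrite rnormE ltcR sub0r normrN ger0_norm ?rnorm_ge0// rnormBC.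
Qed.

Lemma cvg_rnorm (R : realType) (V : normedModType R[i]) (u : nat -> V) (l : V) :
  u @ \oo --> l -> (fun n => rnorm (u n)) @ \oo --> rnorm l.
Proof.
move=> /cvg_rnormP ul; apply/cvgrPdist_lt => e e0.
move/cvgrPdist_lt : ul => /(_ e e0); apply: filterS => n.
rewrite sub0r normrN ger0_norm ?rnorm_ge0//; apply: le_lt_trans.
have tri (v w : V) : rnorm v <= rnorm (v - w) + rnorm w.
  by rewrite -[v in leLHS](subrK w) rnormD.
by rewrite ler_norml lerBrDr addrC lerBlDr lerBlDr addrC tri/= rnormBC tri.
Qed.

Lemma bounded_continuous (R : realType) (V W : normedModType R[i])
    (f : {linear V -> W}) (c : R) :
  (forall x, rnorm (f x) <= c * rnorm x) -> continuous f.
Proof.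
move=> fc; apply/linear_bounded_continuous/linear_boundedP.
exists c%:C; split; first by rewrite complex_real.
move=> M cM x; rewrite (@le_trans _ _ (c%:C * `|x|))//.
  by rewrite !rnormE -rmorphM lecR.
by rewrite ler_wpM2r// ltW.
Qed.

Lemma continuous_bounded (R : realType) (V W : normedModType R[i])
    (f : {linear V -> W}) : continuous f ->
  exists2 c : R, 0 <= c & forall x, rnorm (f x) <= c * rnorm x.
Proof.
move=> /linear_bounded_continuous/linear_boundedP[M [Mr fM]].
have [a aM a0] : exists2 a : R, M < a%:C & 0 <= a.
  have /complex_realP[k ->] := Mr.
  exists (`|k| + 1); last by rewrite addr_ge0.
  by rewrite ltcR (le_lt_trans (ler_norm _))// ltrDl.
exists a => // x; have := fM _ aM x.
by rewrite !rnormE -rmorphM lecR.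
Qed.

Section dual_norm.
Context {R : realType} {F : normedModType R[i]} (f : {linear F -> R[i]^o}).

Let dual_set_neq0 :
  [set rnorm (f x) | x in [set x : F | rnorm x <= 1]] !=set0.
Proof. by exists (rnorm (f 0)), 0; rewrite //= rnorm0. Qed.

(** Together with [rnorm_dual_norm] below: [dual_norm f] is the least bound of
    a continuous [f], so that the supremum never has to be handled again. *)
Lemma dual_norm_le (c : R) : 0 <= c ->
  (forall x, rnorm (f x) <= c * rnorm x) -> dual_norm f <= c.
Proof.
move=> c0 fc; apply: ge_sup => // _ [x /= x1 <-].
by rewrite (le_trans (fc x))// ler_piMr.
Qed.

Hypothesis fcont : continuous f.

Let dual_set_ub :
  has_ubound [set rnorm (f x) | x in [set x : F | rnorm x <= 1]].
Proof.
have [c c0 fc] := continuous_bounded fcont.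
by exists c => _ [x /= x1 <-]; rewrite (le_trans (fc x))// ler_piMr.
Qed.

Lemma dual_norm_ge0 : 0 <= dual_norm f.
Proof.
apply: (le_trans (rnorm_ge0 (f 0))); apply: ub_le_sup => //.
by exists 0; rewrite //= rnorm0.
Qed.

Lemma rnorm_dual_norm x : rnorm (f x) <= dual_norm f * rnorm x.
Proof.
have [->|x0] := eqVneq x 0; first by rewrite linear0 !rnorm0 mulr0.
have rx : 0 < rnorm x by rewrite lt_neqAle rnorm_ge0 eq_sym rnorm_eq0 x0.
rewrite -ler_pdivrMr//; apply: ub_le_sup => //.
exists ((rnorm x)^-1%:C *: x) => /=.
  by rewrite rnormZ rnorm_real ger0_norm ?invr_ge0 ?rnorm_ge0// mulVf ?gt_eqF.
rewrite linearZ/= -[_ *: f x]/(_ * f x) rnormM.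
by rewrite rnorm_real ger0_norm ?invr_ge0 ?rnorm_ge0// mulrC.
Qed.

End dual_norm.

(** Completeness is needed for two kinds of spaces that carry it in different
    forms: local Banach spaces are complete uniform spaces, while the
    completeness of R[i] comes from that of R coordinate by coordinate. The
    criterion below, with a real-valued distance, is common to both. *)
Definition rnorm_cauchy (R : realType) (V : normedZmodType R[i])
    (u : nat -> V) : Prop :=
  forall e : R, 0 < e -> exists N : nat,
    forall m n, (N <= m)%N -> (N <= n)%N -> rnorm (u m - u n) < e.

Lemma complete_rnorm_cauchy (R : realType) (V : completeNormedModType R[i])
  (u : nat -> V) : rnorm_cauchy u -> cvgn u.
Proof.
move=> uc; apply: cauchy_cvg; apply: cauchy_exP => e /gt0_complexP[d d0 ->].
have [N NP] := uc d d0; exists (u N), N => // n /= Nn.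
by rewrite -ball_normE/= rnormE ltcR NP.
Qed.

Lemma ler_rnorm_Re (R : realType) (z : R[i]) : `|complex.Re z| <= rnorm z.
Proof.
case: z => a b /=; rewrite /rnorm normc_def/= -sqrtr_sqr ler_wsqrtr//.
by rewrite lerDl sqr_ge0.
Qed.

Lemma ler_rnorm_Im (R : realType) (z : R[i]) : `|complex.Im z| <= rnorm z.
Proof.
case: z => a b /=; rewrite /rnorm normc_def/= -sqrtr_sqr ler_wsqrtr//.
by rewrite lerDr sqr_ge0.
Qed.

Lemma rnorm_le_ReIm (R : realType) (z : R[i]) :
  rnorm z <= `|complex.Re z| + `|complex.Im z|.
Proof.
rewrite -(@ler_sqr _ _ _) ?nnegrE ?rnorm_ge0 ?addr_ge0//.
case: z => a b; rewrite /rnorm normc_def/= sqr_sqrtr ?addr_ge0 ?sqr_ge0//.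
rewrite sqrrD !real_normK ?num_real// lerD2r lerDl.
by rewrite mulrn_wge0// mulr_ge0.
Qed.

Lemma complex_rnorm_cauchy (R : realType) (u : nat -> R[i]^o) :
  rnorm_cauchy u -> cvgn u.
Proof.
move=> uc.
have real_part (f : R[i] -> R) : (forall z w, f (z - w) = f z - f w) ->
    (forall z, `|f z| <= rnorm z) -> cvgn (f \o u).
  move=> fB fle; apply/cauchy_cvgP/cauchy_exP => e e0.
  have [N NP] := uc e e0; exists (f (u N)), N => // n /= Nn.
  by rewrite -ball_normE/= -fB (le_lt_trans (fle _))// NP.
have ReB (z w : R[i]) : complex.Re (z - w) = complex.Re z - complex.Re w.
  by case: z w => [a b] [c d].
have ImB (z w : R[i]) : complex.Im (z - w) = complex.Im z - complex.Im w.
  by case: z w => [a b] [c d].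
have /cvg_ex[a ua] := real_part _ ReB (@ler_rnorm_Re R).
have /cvg_ex[b ub] := real_part _ ImB (@ler_rnorm_Im R).
apply/cvg_ex; exists (a +i* b); apply/cvg_rnormP.
apply: (@squeeze_cvgr _ _ _ _ (cst 0)
  (fun n => `|complex.Re (u n) - a| + `|complex.Im (u n) - b|)).
- near=> n; rewrite rnorm_ge0/= (le_trans (rnorm_le_ReIm _))//.
  by rewrite ReB ImB.
- exact: cvg_cst.
- rewrite -[X in _ --> X](addr0 (0 : R)).
  by apply: cvgD; apply/norm_cvg0P/subr_cvg0.
Unshelve. all: by end_near. Qed.

(** * Extension to local Banach spaces *)

(** The universal property of the completion: a map that is bounded for [q]
    extends to [local_banach q]. Every point of the completion is a limit of
    points of [E]; the images form a Cauchy sequence, and the bound by [c],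
    applied to the difference of two approximating sequences, shows that the
    limit is the same for both. All bounded maps out of local Banach spaces
    used below, canonical maps and coordinate functionals, come from here. *)
Lemma local_banach_extension (R : realType) (E : lmodType R[i])
    (q : seminorm E) (F : normedModType R[i])
    (F_complete : forall u : nat -> F, rnorm_cauchy u -> cvgn u)
    (phi : {linear E -> F}) (c : R) :
  0 <= c -> (forall x, rnorm (phi x) <= c * q x) ->
  exists2 f : {linear local_banach q -> F},
    (forall x, rnorm (f x) <= c * rnorm x) &
    forall x, f (to_local_banach q x) = phi x.
Proof.
move=> c0 phic.
pose approx (x : local_banach q) (z : nat -> E) :=
  (fun n => to_local_banach q (z n)) @ \oo --> x.
have approx_ex x : exists z, approx x z.
  have /choice[z zP] (n : nat) : exists y : E,
      rnorm (x - to_local_banach q y) < n.+1%:R^-1.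
    exact: to_local_banach_dense.
  exists z; apply/cvg_rnormP.
  apply: (@squeeze_cvgr _ _ _ _ (cst 0) (fun n => n.+1%:R^-1)).
  - by near=> n; rewrite rnorm_ge0 rnormBC ltW.
  - exact: cvg_cst.
  - exact: cvg_harmonic.
have approx_cvg x z : approx x z -> cvgn (fun n => phi (z n)).
  move=> /cvg_rnormP xz; apply: F_complete => e e0.
  have c1 : 0 < c + 1 by rewrite ltr_wpDl.
  move/cvgrPdist_lt : xz => /(_ (e / 2 / (c + 1))).
  rewrite !divr_gt0// => /(_ isT)[N _ NP]; exists N => m n Nm Nn.
  have {}NP k : (N <= k)%N ->
      rnorm (to_local_banach q (z k) - x) < e / 2 / (c + 1).
    by move=> /NP /=; rewrite sub0r normrN ger0_norm ?rnorm_ge0.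
  rewrite -linearB (le_lt_trans (phic _))// -to_local_banach_norm linearB/=.
  rewrite (@le_lt_trans _ _ ((c + 1) *
    (rnorm (to_local_banach q (z m) - x) + rnorm (to_local_banach q (z n) - x))))//.
    rewrite ler_pM ?rnorm_ge0 ?lerDl//.
    rewrite -[to_local_banach q (z m) in leLHS](subrK x) -addrA.
    by rewrite (le_trans (rnormD _ _))// lerD2l rnormBC.
  rewrite mulrC -ltr_pdivlMr// (splitr e) mulrDl.
  by rewrite ltrD ?NP.
have approx_le x z l : approx x z -> phi \o z @ \oo --> l ->
    rnorm l <= c * rnorm x.
  move=> xz zl.
  have nl : (fun n => rnorm (phi (z n))) @ \oo --> rnorm l by exact: cvg_rnorm.
  have nx : (fun n => c * rnorm (to_local_banach q (z n))) @ \oo --> c * rnorm x.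
    by apply: cvgMr; exact: cvg_rnorm.
  apply: (ler_cvg_to nl nx).
  by near=> n; rewrite to_local_banach_norm.
have /choice[zs zsP] := approx_ex.
pose f x : F := lim ((fun n => phi (zs x n)) @ \oo).
have fE x z : approx x z -> (fun n => phi (z n)) @ \oo --> f x.
  move=> xz; have /cvg_ex[l zl] := approx_cvg _ _ xz.
  suff -> : f x = l by [].
  apply/eqP; rewrite -subr_eq0 -rnorm_eq0 eq_le rnorm_ge0 andbT.
  rewrite -(mulr0 c) -(@rnorm0 R (local_banach q)).
  apply: (approx_le _ (zs x - z)).
    rewrite /approx -(subrr x).
    under eq_fun do rewrite -[(_ - _) _]/(zs x _ - z _) linearB.
    by apply: cvgB => //; exact: zsP.
  rewrite (_ : _ \o _ = (fun n => phi (zs x n) - phi (z n))).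
    by apply: cvgB => //; exact: approx_cvg (zsP x).
  by apply/funext => n; rewrite -linearB.
have f_linear : linear f.
  move=> a x y; apply: (@cvg_unique F (@norm_hausdorff _ F)
    ((fun n => phi (a *: zs x n + zs y n)) @ \oo)).
    apply: fE; rewrite /approx (_ : (fun _ => _) = (fun n =>
      a *: to_local_banach q (zs x n) + to_local_banach q (zs y n))).
      by apply: cvgD; [apply: cvgZl_tmp|]; exact: zsP.
    by apply/funext => n; rewrite linearP.
  rewrite (_ : (fun _ => _) = (fun n => a *: phi (zs x n) + phi (zs y n))).
    by apply: cvgD; [apply: cvgZl_tmp|]; exact/fE/zsP.
  by apply/funext => n; rewrite linearP.
pose fL : {linear local_banach q -> F} :=
  HB.pack f (GRing.isLinear.Build R[i] (local_banach q) F *:%R f f_linear).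
exists fL => x; first exact: approx_le (zsP x) (fE _ _ (zsP x)).
have fx : (fun=> phi x) @ \oo --> f (to_local_banach q x).
  by apply: (fE _ (cst x)); rewrite /approx /=; exact: cvg_cst.
apply: (@cvg_unique F (@norm_hausdorff _ F) _ _ _ _ fx).
exact: cvg_cst.
Unshelve. all: by end_near. Qed.

(** * Norms, truncations and coordinates on the power series space *)

Section scale_seminorm.
Context {R : realType} {E : lmodType R[i]} (c : {nonneg R}) (p : seminorm E).

Let scaleD x y : c%:num * p (x + y) <= c%:num * p x + c%:num * p y.
Proof. by rewrite -mulrDr ler_wpM2l// seminormD. Qed.

Let scaleZ (a : R[i]) x : c%:num * p (a *: x) = rnorm a * (c%:num * p x).
Proof. by rewrite seminormZ mulrCA. Qed.

Definition scale_seminorm : seminorm E := Seminorm scaleD scaleZ.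

End scale_seminorm.

Section Lambda0_theory.
Context {R : realType} (alpha : nat -> R).
Hypothesis alphaP : increases_to_infinity alpha.

Local Notation w := (weight alpha).
Local Notation L := (Lambda0 alpha).
Local Notation pn k := (Lambda0_seminorm alpha k : seminorm L).

Lemma alpha_gt0 n : 0 < alpha n.
Proof. by case: alphaP => a1 _ _; rewrite (lt_trans ltr01). Qed.

Lemma weight_gt0 k n : 0 < w k n.
Proof. exact: expR_gt0. Qed.

Lemma weight_le1 k n : w k n <= 1.
Proof.
by rewrite -expR0 ler_expR oppr_le0 divr_ge0// ltW// alpha_gt0.
Qed.

Lemma weight_homo k l n : (k <= l)%N -> w k n <= w l n.
Proof.
move=> kl; rewrite ler_expR lerN2 ler_pM2l ?alpha_gt0//.
by rewrite lef_pV2 ?posrE// ler_nat.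
Qed.

Lemma weight_anti k m n : (m <= n)%N -> w k n <= w k m.
Proof.
move=> mn; case: alphaP => _ inc _; rewrite ler_expR lerN2 ler_pM2r//.
by have /nondecreasing_seqP := fun n => ltW (inc n); exact.
Qed.

Lemma Lambda0_norm_homo k l (x : L) : (k <= l)%N -> pn k x <= pn l x.
Proof.
move=> kl; apply: Lambda0_norm_le => n.
rewrite (le_trans _ (Lambda0_norm_ub l x n))//.
by rewrite ler_wpM2r ?rnorm_ge0// weight_homo.
Qed.

Lemma dominated_seminorm_continuous (p : seminorm L) (N : nat) (C : R) :
  0 < C -> (forall x, p x <= C * pn N x) -> continuous p.
Proof.
move=> C0 pC x; apply/(@cvgrPdist_lt _ _ _ (nbhs (x : L))) => e e0.
exists N, (e / C); split; first by rewrite divr_gt0.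
move=> y xy /=; rewrite (le_lt_trans (seminorm_dist _ _ _))//.
rewrite seminormBC (le_lt_trans (pC _))// mulrC -ltr_pdivlMr//.
exact: xy.
Qed.

Lemma Lambda0_seminorm_continuous k : continuous (pn k).
Proof.
by apply: (@dominated_seminorm_continuous _ k 1) => // x; rewrite mul1r.
Qed.

(** The norms of the space increase, so a neighbourhood of 0 contains a ball
    of a single one of them, and homogeneity turns the inclusion of that ball
    in the unit ball of [p] into an inequality. *)
Lemma continuous_seminorm_dominated (p : seminorm L) : continuous p ->
  exists (N : nat) (C : R), 0 < C /\ forall x, p x <= C * pn N x.
Proof.
move=> /(_ 0)/(@cvgrPdist_lt _ _ _ (nbhs (0 : L))).
move=> /(_ 1 ltr01)[N [e [e0 eP]]].
exists N, e^-1; split => [|x]; first by rewrite invr_gt0.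
(* The norm of [x] may vanish, so [x] is rescaled by a slightly larger number. *)
apply/ler_addgt0Pr => d d0.
have r0 : 0 < pn N x + e * d by rewrite ltr_wpDl ?seminorm_ge0// mulr_gt0.
pose t : R := e / (pn N x + e * d).
have t0 : 0 < t by rewrite divr_gt0.
have : seminorm_ball (0 : L) N e (t%:C *: x).
  move=> k kN; rewrite subr0 seminormZ rnorm_real gtr0_norm//.
  rewrite /t mulrAC ltr_pdivrMr// ltr_pM2l//.
  by rewrite (le_lt_trans (Lambda0_norm_homo _ kN))// ltrDl mulr_gt0.
move=> /eP /=; rewrite seminorm0 sub0r normrN ger0_norm ?seminorm_ge0//.
rewrite seminormZ rnorm_real gtr0_norm// mulrC -ltr_pdivlMr// mul1r.
rewrite /t invf_div => /ltW; rewrite mulrDl => /le_trans; apply.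
by rewrite mulrC lerD2l mulrAC mulfV ?gt_eqF// mul1r.
Qed.

Definition trunc_seq (s : nat -> R[i]) (M : nat) : nat -> R[i] :=
  fun n => if (n < M)%N then s n else 0.

Lemma trunc_Lambda0 s M : trunc_seq s M \in Lambda0_pred alpha.
Proof.
apply/asboolP => k; apply: cvg_near_cst.
by exists M => // n /= Mn; rewrite /trunc_seq ltnNge Mn rnorm0 mulr0.
Qed.

Definition trunc s M : L := MkLambda0_seq (trunc_Lambda0 s M).

Definition unit_vector n : L := trunc (fun i => (i == n)%:R) n.+1.

Lemma unit_vectorE n i : Lambda0_val (unit_vector n) i = (i == n)%:R.
Proof.
rewrite /= /trunc_seq ltnS; case: leqP => // ni.
by rewrite (gtn_eqF ni).
Qed.

Lemma trunc_sum s M : trunc s M = \sum_(n < M) s n *: unit_vector n.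
Proof.
elim: M => [|M IH].
  by rewrite big_ord0; apply: val_inj; apply/funext => n.
rewrite big_ord_recr /= -IH; apply: val_inj; apply/funext => n.
rewrite -[RHS]/(trunc_seq s M n + s M * Lambda0_val (unit_vector M) n).
rewrite unit_vectorE /= /trunc_seq ltnS leq_eqVlt.
case: eqVneq => [->|nM] /=; first by rewrite ltnn add0r mulr1.
by rewrite mulr0 addr0.
Qed.

Lemma Lambda0_norm_trunc_le k s M (C : R) :
  (forall n, (n < M)%N -> w k n * rnorm (s n) <= C) -> 0 <= C ->
  pn k (trunc s M) <= C.
Proof.
move=> sC C0; apply: Lambda0_norm_le => n /=; rewrite /trunc_seq.
by case: ifP => [/sC//|_]; rewrite rnorm0 mulr0.
Qed.

Lemma Lambda0_norm_unit_vector k n : pn k (unit_vector n) = w k n.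
Proof.
apply/eqP; rewrite eq_le; apply/andP; split.
  apply: Lambda0_norm_le => i; rewrite unit_vectorE.
  case: eqVneq => [->|_]; first by rewrite rnorm1 mulr1.
  by rewrite rnorm0 mulr0 ltW// weight_gt0.
rewrite (le_trans _ (Lambda0_norm_ub k _ n))// unit_vectorE eqxx rnorm1.
by rewrite mulr1.
Qed.

Lemma trunc_cvg k (x : L) :
  (fun M => pn k (x - trunc (Lambda0_val x) M)) @ \oo --> (0 : R).
Proof.
apply/cvgrPdist_le => e e0.
have /asboolP/(_ k)/cvgrPdist_le/(_ e e0)[N _ NP] := valP (x : Lambda0_seq alpha).
exists N => // M /= NM; rewrite sub0r normrN ger0_norm; last first.
  exact: (seminorm_ge0 (pn k)).
apply: Lambda0_norm_le => n.
rewrite -[Lambda0_val _ _]/(Lambda0_val x n - trunc_seq (Lambda0_val x) M n).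
rewrite /trunc_seq; case: ltnP => nM.
  by rewrite subrr rnorm0 mulr0 ltW.
have := NP n (leq_trans NM nM); rewrite /= sub0r normrN subr0.
by rewrite ger0_norm// mulr_ge0 ?rnorm_ge0// ltW// weight_gt0.
Qed.

Definition coord_fun (n : nat) (x : L) : R[i]^o := Lambda0_val x n.

Lemma coord_linear n : linear (coord_fun n).
Proof. by []. Qed.

HB.instance Definition _ n := GRing.isLinear.Build R[i] L R[i]^o *:%R
  (coord_fun n) (coord_linear n).

Lemma coord_le k n (x : L) : rnorm (coord_fun n x) <= (w k n)^-1 * pn k x.
Proof.
by rewrite mulrC ler_pdivlMr ?weight_gt0// mulrC; exact: Lambda0_norm_ub.
Qed.

(** The coordinates remain continuous functionals on the completion for any
    seminorm that dominates a multiple of some norm of the space, with a bound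
    read off from the weight. *)
Lemma coord_extension (q : seminorm L) (k n : nat) (C : R) :
  0 <= C -> (forall x, pn k x <= C * q x) ->
  exists2 f : {linear local_banach q -> R[i]^o},
    (forall x, rnorm (f x) <= C / w k n * rnorm x) &
    forall x : L, f (to_local_banach q x) = Lambda0_val x n.
Proof.
move=> C0 pq; apply: (local_banach_extension (@complex_rnorm_cauchy R)
  (phi := coord_fun n)).
  by rewrite divr_ge0// ltW// weight_gt0.
move=> x; rewrite (le_trans (coord_le k n x))//.
by rewrite mulrAC [leRHS]mulrC ler_pM2l ?invr_gt0 ?weight_gt0.
Qed.

End Lambda0_theory.

(** * The logarithmic condition and the decay of the weights *)

Section growth.
Context {R : realType} (alpha : nat -> R).
Hypothesis alphaP : increases_to_infinity alpha.

Local Notation w := (weight alpha).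

Lemma ln_natr_ge0 n : 0 <= ln (n.+1%:R : R).
Proof. by rewrite ln_ge0// ler1n. Qed.

(** The form in which the logarithmic condition is reached from nuclearity and
    from the point spectrum: taking logarithms, ln (n + 1) is at most
    alpha_n / (k + 1) plus a constant, and the constant is negligible because
    alpha tends to infinity, while k is arbitrary. *)
Lemma log_negligible :
  (forall k, exists C : R, forall n, n.+1%:R * w k n <= C) ->
  (fun n => ln n.+1%:R / alpha n) @ \oo --> (0 : R).
Proof.
move=> wC; apply/cvgrPdist_le => e e0.
have e20 : 0 < e / 2 by rewrite divr_gt0.
(* [k] makes 1 / (k + 1) smaller than half of the target. *)
have [k _ /(_ k (leqnn k)) ke] := near_infty_natSinv_lt (PosNum e20).
have [C CP] := wC k.
have C0 : 0 < C.
  by rewrite (lt_le_trans _ (CP 0))// mul1r weight_gt0.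
have [_ _ /cvgryPge/(_ (`|ln C| / (e / 2)))] := alphaP.
apply: filterS => n alphaC.
have an0 : 0 < alpha n by exact: alpha_gt0.
rewrite sub0r normrN ger0_norm; last first.
  by rewrite divr_ge0 ?ln_natr_ge0// ltW.
rewrite ler_pdivrMr//.
have : ln (n.+1%:R * w k n) <= ln C.
  by rewrite ler_ln ?posrE ?mulr_gt0 ?weight_gt0//.
rewrite lnM ?posrE ?weight_gt0// expRK lerBlDr => /le_trans; apply.
rewrite (splitr e) mulrDl lerD//.
  by rewrite (le_trans (ler_norm _))// mulrC -ler_pdivrMr.
by rewrite mulrC ler_wpM2r// ltW.
Qed.

(** Conversely, once ln (n + 1) is smaller than any multiple of alpha_n, the
    weights decrease faster than every power of n. One power more than
    required is absorbed, which leaves a factor 1 / (n + 1) to force the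
    convergence. *)
Lemma power_weight_cvg0 :
  (fun n => ln n.+1%:R / alpha n) @ \oo --> (0 : R) ->
  forall k m, (fun n => n.+1%:R ^+ m * w k n) @ \oo --> (0 : R).
Proof.
move=> lna k m.
apply: (@squeeze_cvgr _ _ _ _ (cst 0) (fun n => n.+1%:R^-1)).
- have c0 : 0 < (m.+1%:R * k.+1%:R)^-1 :> R by rewrite invr_gt0 mulr_gt0.
  move/cvgrPdist_le : lna => /(_ _ c0); apply: filterS => n.
  have an0 : 0 < alpha n by exact: alpha_gt0.
  rewrite sub0r normrN ger0_norm; last first.
    by rewrite divr_ge0 ?ln_natr_ge0// ltW.
  rewrite ler_pdivrMr// => lnn.
  rewrite mulr_ge0 ?exprn_ge0 ?(ltW (weight_gt0 _ _ _))//=.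
  rewrite -[leRHS]mul1r ler_pdivlMr// mulrAC -exprSr.
  rewrite -[X in X ^+ _](@lnK R) ?posrE// -expRM_natl -expRD.
  rewrite -[leRHS]expR0 ler_expR subr_le0 (le_trans (ler_wpM2l _ lnn))//.
  by rewrite invfM !mulrA divff// mul1r mulrC.
- exact: cvg_cst.
- exact: cvg_harmonic.
Qed.

End growth.

(** * From nuclearity to the decay of the weights *)

Lemma rnorm_phase (R : realType) (z : R[i]) :
  exists2 t : R[i], rnorm t <= 1 & t * z = (rnorm z)%:C.
Proof.
have [->|z0] := eqVneq z 0.
  by exists 0; rewrite ?rnorm0 ?ler01// mul0r.
exists ((rnorm z)%:C / z); last by rewrite mulfVK.
rewrite -(@ler_pM2r _ (rnorm z)); last first.
  by rewrite lt_neqAle rnorm_ge0 eq_sym rnorm_eq0 z0.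
by rewrite -rnormM mulfVK// rnorm_real mul1r ger0_norm ?rnorm_ge0.
Qed.

Section nuclear_growth.
Context {R : realType} (alpha : nat -> R).
Hypothesis alphaP : increases_to_infinity alpha.

Local Notation w := (weight alpha).
Local Notation L := (Lambda0 alpha).
Local Notation pn k := (Lambda0_seminorm alpha k : seminorm L).
Local Notation e n := (unit_vector alpha n).

(** The values of a functional on the unit vectors are absolutely summable, as
    for the dual of c_0: by a choice of phases as coefficients the sum of the
    moduli becomes the value of the functional at a vector all of whose
    coordinates have modulus at most 1, and such vectors are bounded because
    the weights are at most 1. *)
Lemma functional_abs_sum (q : seminorm L) (N : nat) (C : R)
    (f : {linear local_banach q -> R[i]^o}) (M : nat) :
  0 <= C -> (forall x, q x <= C * pn N x) -> continuous f ->
  \sum_(n < M) rnorm (f (to_local_banach q (e n))) <= dual_norm f * C.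
Proof.
move=> C0 qC fc.
have /choice[t tP] (n : nat) : exists t : R[i], rnorm t <= 1 /\
    t * f (to_local_banach q (e n)) = (rnorm (f (to_local_banach q (e n))))%:C.
  by have [t ? ?] := rnorm_phase (f (to_local_banach q (e n))); exists t.
have fE : f (to_local_banach q (trunc alpha t M)) =
    (\sum_(n < M) rnorm (f (to_local_banach q (e n))))%:C.
  rewrite trunc_sum !linear_sum/= rmorph_sum/=.
  by apply: eq_bigr => n _; rewrite !linearZ/=; exact: (tP n).2.
rewrite (le_trans (ler_norm _))// -rnorm_real -fE.
rewrite (le_trans (rnorm_dual_norm fc _))// ler_wpM2l ?dual_norm_ge0//.
rewrite to_local_banach_norm (le_trans (qC _))// ler_piMr//.
apply: Lambda0_norm_trunc_le => // n _.
rewrite -[leRHS]mulr1 ler_pM ?rnorm_ge0 ?(ltW (weight_gt0 _ _ _)) ?weight_le1//.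
exact: (tP n).1.
Qed.

(** A trace argument. Write T as the sum of the f_j tensor y_j. Since T maps
    the class of the unit vector e_n to the class of e_n, its n-th diagonal
    entry, the sum over j of f_j(e_n) times the n-th coordinate of y_j, is 1.
    After multiplication by the weight, which bounds the coordinate of y_j by
    a multiple of the norm of y_j, summation over n and exchange of the sums,
    [functional_abs_sum] bounds the sum of the weights by the sum over j of
    the norms of f_j and y_j. *)
Lemma nuclear_weight_sum_le (p q : seminorm L) (k N : nat) (Cp Cq : R)
    (T : {linear local_banach q -> local_banach p}) :
  0 <= Cp -> (forall x, pn k x <= Cp * p x) ->
  0 <= Cq -> (forall x, q x <= Cq * pn N x) ->
  canonical_map T -> nuclear_operator T ->
  exists C : R, forall M, \sum_(n < M) w k n <= C.
Proof.
move=> Cp0 pCp Cq0 qCq [Tc TE] [f [y [fc fy_cvg fyT]]].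
have /choice[g gP] (n : nat) : exists g : {linear local_banach p -> R[i]^o},
    (forall x, rnorm (g x) <= Cp / w k n * rnorm x) /\
    forall x : L, g (to_local_banach p x) = Lambda0_val x n.
  by have [g ? ?] := coord_extension n Cp0 pCp; exists g.
pose term j := dual_norm (f j) * rnorm (y j).
have term0 j : 0 <= term j by rewrite mulr_ge0 ?dual_norm_ge0 ?rnorm_ge0.
pose S := limn (series term).
have termS J : \sum_(j < J) term j <= S.
  have nd : nondecreasing_seq (series term).
    by apply: nondecreasing_series => j _ _; exact: term0.
  by have := nondecreasing_cvgn_le nd fy_cvg J; rewrite /series/= big_mkord.
exists (Cp * Cq * S) => M.
pose s n J := series (fun j => f j (to_local_banach q (e n)) *: y j) J.
have s_le J : \sum_(n < M) w k n * rnorm (g n (s n J)) <= Cp * Cq * S.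
  apply: (@le_trans _ _ (\sum_(n < M) \sum_(j < J)
      rnorm (f j (to_local_banach q (e n))) * (Cp * rnorm (y j)))).
    apply: ler_sum => n _.
    rewrite /s /series /= big_mkord linear_sum/=.
    rewrite (le_trans (ler_wpM2l (ltW (weight_gt0 _ _ _)) (rnorm_sum _ _ _)))//.
    rewrite mulr_sumr; apply: ler_sum => j _.
    rewrite linearZ/= rnormM mulrCA ler_wpM2l ?rnorm_ge0//.
    rewrite (le_trans (ler_wpM2l (ltW (weight_gt0 _ _ _)) ((gP n).1 _)))//.
    by rewrite mulrA mulrCA mulfV ?mulr1// gt_eqF// weight_gt0.
  rewrite exchange_big/= (@le_trans _ _ (\sum_(j < J) Cp * Cq * term j))//.
    apply: ler_sum => j _; rewrite -mulr_suml.
    rewrite (le_trans (ler_wpM2r _ (functional_abs_sum M Cq0 qCq (fc j))))//.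
      by rewrite mulr_ge0// rnorm_ge0.
    by rewrite /term le_eqVlt; apply/orP; left; apply/eqP; ring.
  by rewrite -mulr_sumr ler_wpM2l// mulr_ge0.
(* The diagonal entry of T, obtained as a limit of those of its partial sums. *)
have s_cvg n : (fun J => rnorm (g n (s n J))) @ \oo --> (1 : R).
  have -> : (1 : R) = rnorm (g n (T (to_local_banach q (e n)))).
    by rewrite TE (gP n).2 unit_vectorE eqxx rnorm1.
  apply: cvg_rnorm; apply: continuous_cvg.
    exact: (bounded_continuous (gP n).1).
  exact: fyT.
have sum_cvg : (fun J => \sum_(n < M) w k n * rnorm (g n (s n J))) @ \oo -->
    \sum_(n < M) w k n.
  under [X in _ --> X]eq_bigr do rewrite -[w k _]mulr1.
  elim: {s_le} M => [|M IH].
    rewrite big_ord0 (_ : (fun _ => _) = cst 0); first exact: cvg_cst.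
    by apply/funext => J; rewrite big_ord0.
  rewrite big_ord_recr/= (_ : (fun _ => _) = (fun J =>
    \sum_(n < M) w k n * rnorm (g n (s n J)) + w k M * rnorm (g M (s M J)))).
    by apply: cvgD => //; apply: cvgMr.
  by apply/funext => J; rewrite big_ord_recr.
by apply: (ler_cvg_to sum_cvg (cvg_cst _)); near=> J; exact: s_le.
Unshelve. all: by end_near. Qed.

(** The weights decrease with n, so that (n + 1) times the n-th one is at most
    the sum of the first n + 1. *)
Lemma nuclear_weight_growth : nuclear_space L ->
  forall k, exists C : R, forall n, n.+1%:R * w k n <= C.
Proof.
move=> nuc k.
have [q [qc pq [T TE Tn]]] := nuc _ (@Lambda0_seminorm_continuous R alpha k).
have [N [Cq [Cq0 qCq]]] := continuous_seminorm_dominated alphaP qc.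
have p1 (x : L) : pn k x <= 1 * pn k x by rewrite mul1r.
have [C CP] := nuclear_weight_sum_le ler01 p1 (ltW Cq0) qCq TE Tn.
exists C => n; rewrite (le_trans _ (CP n.+1))//.
rewrite mulr_natl -[X in _ *+ X]card_ord -sumr_const.
by apply: ler_sum => i _; apply: weight_anti => //; rewrite -ltnS.
Qed.

End nuclear_growth.

(** * From the decay of the weights to nuclearity *)

Section nuclear_of_log.
Context {R : realType} (alpha : nat -> R).
Hypothesis alphaP : increases_to_infinity alpha.

Local Notation w := (weight alpha).
Local Notation L := (Lambda0 alpha).
Local Notation pn k := (Lambda0_seminorm alpha k : seminorm L).
Local Notation e n := (unit_vector alpha n).

(** The weights are bounded by a multiple of 1 / ((n + 1) (n + 2)), a
    telescoping term. *)
Lemma weight_sum_le :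
  (fun n => ln n.+1%:R / alpha n) @ \oo --> (0 : R) ->
  forall k, exists2 B : R, 0 <= B & forall M, \sum_(n < M) w k n <= B.
Proof.
move=> lna k.
have [B0 [_ B0P]] :=
  cvg_seq_bounded (cvgP _ (@power_weight_cvg0 R alpha alphaP lna k 2)).
pose B := `|B0| + 1.
have BP n : n.+1%:R ^+ 2 * w k n <= B.
  rewrite (le_trans (ler_norm _))//; apply: B0P => //.
  by rewrite (le_lt_trans (ler_norm _))// ltrDl.
have Bge0 : 0 <= B by rewrite addr_ge0.
exists (2 * B); first by rewrite mulr_ge0.
move=> M; apply: (@le_trans _ _ (2 * B * (1 - M.+1%:R^-1))); last first.
  by rewrite ler_piMr ?mulr_ge0// gerBl invr_ge0.
elim: M => [|M IH]; first by rewrite big_ord0 invr1 subrr mulr0.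
rewrite big_ord_recr/= (le_trans (lerD IH (lexx _)))//.
rewrite -lerBrDl -mulrBr.
have -> : 1 - M.+2%:R^-1 - (1 - M.+1%:R^-1) = (M.+1%:R * M.+2%:R)^-1 :> R.
  rewrite -[M.+2%:R]natr1; move: (M.+1%:R : R) (ltr0Sn R M) => a a0.
  by field; rewrite !gt_eqF// addr_gt0.
rewrite ler_pdivlMr ?mulr_gt0//.
have M12 : M.+2%:R <= 2 * M.+1%:R :> R.
  by rewrite -natrM ler_nat mul2n -addnn addSn addnS !ltnS leq_addr.
rewrite (@le_trans _ _ (2 * (M.+1%:R ^+ 2 * w k M)))//; last by rewrite ler_pM2l.
have -> : 2 * (M.+1%:R ^+ 2 * w k M) = w k M * (M.+1%:R * (2 * M.+1%:R)) by ring.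
by rewrite ler_wpM2l ?(ltW (weight_gt0 _ _ _))// ler_wpM2l.
Qed.

(** The canonical map is the sum of coordinate functionals tensor unit vectors.
    If [p] is dominated by the N-th norm, take for [q] a multiple of the norm
    with index K = 2 N + 1: then w_N is the square of w_K, the n-th term has
    norm at most w_N(n) / w_K(n) = w_K(n), and these weights are summable. The
    series represents the map on the space itself because truncations
    converge, hence on the whole completion by density, the partial sums being
    uniformly bounded. *)
Lemma log_nuclear :
  (fun n => ln n.+1%:R / alpha n) @ \oo --> (0 : R) -> nuclear_space L.
Proof.
move=> lna p pc.
have [N [C [C0 pC]]] := continuous_seminorm_dominated alphaP pc.
pose K := (2 * N).+1.
have wK n : w N n = w K n ^+ 2.
  rewrite /weight -expRM_natl; congr expR.
  have -> : K.+1 = (2 * N.+1)%N by rewrite mulnS.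
  rewrite natrM; move: (N.+1%:R : R) (ltr0Sn R N) => b b0.
  by field; rewrite gt_eqF.
pose q := scale_seminorm (NngNum (ltW C0)) (pn K).
have pq (x : L) : p x <= q x.
  rewrite (le_trans (pC x))// /q /= ler_pM2l//.
  by apply: Lambda0_norm_homo => //; rewrite /K ltnW// ltnS leq_pmull.
have qpn (x : L) : pn K x <= C^-1 * q x.
  by rewrite /q /= mulrA mulVf ?mul1r// gt_eqF.
exists q; split => //.
  by apply: (dominated_seminorm_continuous (N := K) C0) => x.
have [T T1 TE] : exists2 T : {linear local_banach q -> local_banach p},
    (forall x, rnorm (T x) <= 1 * rnorm x) &
    forall x : L, T (to_local_banach q x) = to_local_banach p x.
  apply: (local_banach_extension _ (phi := @to_local_banach R L p)) => //.
    exact: complete_rnorm_cauchy.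
  by move=> x; rewrite to_local_banach_norm mul1r.
exists T; first by split => //; exact: bounded_continuous T1.
have Ci0 : 0 <= C^-1 by rewrite invr_ge0 ltW.
have /choice[f fP] (n : nat) : exists f : {linear local_banach q -> R[i]^o},
    (forall x, rnorm (f x) <= C^-1 / w K n * rnorm x) /\
    forall x : L, f (to_local_banach q x) = Lambda0_val x n.
  by have [f ? ?] := coord_extension n Ci0 qpn; exists f.
pose y n := to_local_banach p (e n).
have y_le n : rnorm (y n) <= C * w K n ^+ 2.
  by rewrite to_local_banach_norm (le_trans (pC _))// Lambda0_norm_unit_vector wK.
have fc n : continuous (f n) by exact: bounded_continuous (fP n).1.
have cy_le n : C^-1 / w K n * rnorm (y n) <= w K n.
  have w0 := weight_gt0 alpha K n.
  rewrite (le_trans (ler_wpM2l _ (y_le n)))//.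
    by rewrite divr_ge0// ltW.
  by rewrite mulrACA mulVf ?gt_eqF// mul1r expr2 mulKf// gt_eqF.
have [B B0 BP] := weight_sum_le lna K.
exists f, y; split => //.
  apply: nondecreasing_is_cvgn.
    apply: nondecreasing_series => n _ _.
    by rewrite mulr_ge0 ?dual_norm_ge0 ?rnorm_ge0.
  exists B => _ [M _ <-]; rewrite /series /= big_mkord (le_trans _ (BP M))//.
  apply: ler_sum => n _; rewrite (le_trans _ (cy_le n))// ler_wpM2r ?rnorm_ge0//.
  apply: dual_norm_le; last exact: (fP n).1.
  by rewrite mulr_ge0// invr_ge0 ltW// weight_gt0.
pose S x M := series (fun n => f n x *: y n) M.
have S_le x M : rnorm (S x M) <= B * rnorm x.
  rewrite /S /series /= big_mkord (le_trans (rnorm_sum _ _ _))//.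
  rewrite (le_trans _ (ler_wpM2r (rnorm_ge0 _) (BP M)))// mulr_suml.
  apply: ler_sum => n _; rewrite rnormZ.
  rewrite (le_trans (ler_wpM2r (rnorm_ge0 _) ((fP n).1 x)))//.
  by rewrite mulrAC ler_wpM2r ?rnorm_ge0.
have S_lin x z M : S x M - S z M = S (x - z) M.
  rewrite /S /series /= !big_mkord -sumrB; apply: eq_bigr => n _.
  by rewrite linearB scalerBl.
have S_E (z : L) M :
    S (to_local_banach q z) M = to_local_banach p (trunc alpha (Lambda0_val z) M).
  rewrite trunc_sum linear_sum /S /series /= big_mkord.
  by apply: eq_bigr => n _; rewrite (fP n).2 linearZ.
move=> x; apply/cvg_rnormP/cvgrPdist_lt => d d0.
have B1 : 0 < B + 1 by rewrite ltr_wpDl.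
have [z xz] := to_local_banach_dense x
  (divr_gt0 (divr_gt0 d0 (ltr0Sn R 1)) B1).
have Cd : 0 < d / 2 / C by rewrite !divr_gt0.
move: (@trunc_cvg R alpha N z) => /cvgrPdist_lt/(_ _ Cd).
apply: filterS => M; rewrite !sub0r !normrN.
rewrite ger0_norm; last exact: (seminorm_ge0 (pn N)).
rewrite ltr_pdivlMr// mulrC => zM.
rewrite ger0_norm ?rnorm_ge0//.
have -> : series (fun n => f n x *: y n) M - T x =
    (S (x - to_local_banach q z) M - T (x - to_local_banach q z)) +
    (S (to_local_banach q z) M - T (to_local_banach q z)).
  by rewrite -S_lin linearB opprB addrAC !addrA !subrK.
rewrite (le_lt_trans (rnormD _ _))// (splitr d) ltrD//.
  rewrite (le_lt_trans (rnormD _ _))// rnormN.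
  rewrite (le_lt_trans (lerD (S_le _ _) (T1 _)))// -mulrDl mulrC.
  by rewrite -ltr_pdivlMr.
rewrite S_E TE -linearB to_local_banach_norm seminormBC.
exact: le_lt_trans (pC _) zM.
Qed.

End nuclear_of_log.

(** * The point spectrum of the Cesaro operator *)

Lemma point_spectrumP (R : realType) (X : lmodType R[i])
    (T : {linear X -> X}) (l : R[i]) :
  point_spectrum T l <-> exists2 x : X, x != 0 & T x = l *: x.
Proof.
split=> [|[x x0 Tx] inj]; last first.
  by move/eqP : x0; apply; apply: inj; rewrite /= Tx !linear0 addr0 subrr.
apply: contra_notP => noeig x y /= xy.
apply/eqP; rewrite -subr_eq0; apply/negPn/negP => xy0; apply: noeig.
exists (x - y) => //; rewrite linearB scalerBr.
by rewrite -[l *: x](subrK (T x)) xy [RHS]addrC !addrA addNr add0r addrC.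
Qed.

(** The equation says that the n-th partial sum of x is l (n + 1) x_n;
    subtracting two consecutive instances leaves a two-term recurrence. *)
Lemma cesaro_eigen_recurrence (R : realType) (x : nat -> R[i]) (l : R[i]) :
  (forall n, cesaro_seq x n = l * x n) ->
  (l - 1) * x 0%N = 0 /\
  forall n, (l * n.+2%:R - 1) * x n.+1 = l * n.+1%:R * x n.
Proof.
move=> xl.
have sumE n : \sum_(i < n.+1) x i = l * n.+1%:R * x n.
  have := xl n; rewrite /cesaro_seq => /(congr1 ( *%R^~ n.+1%:R)).
  by rewrite divfK ?pnatr_eq0// => ->; rewrite mulrAC.
split=> [|n].
  by have := sumE 0%N; rewrite big_ord1 mulr1 mulrBl mul1r => {2}->; rewrite subrr.
have := sumE n.+1; rewrite big_ord_recr/= sumE mulrBl mul1r => <-.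
by rewrite addrK.
Qed.

(** The recurrence at the first nonzero entry, of index m, forces
    l (m + 1) = 1, and then determines the later entries. *)
Lemma cesaro_eigenvalue (R : realType) (x : nat -> R[i]) (l : R[i]) :
  (forall n, cesaro_seq x n = l * x n) -> (exists n, x n != 0) ->
  exists m : nat, [/\ x m != 0, l = m.+1%:R^-1 &
    forall n, (m <= n)%N -> (n.+1 - m)%:R * x n.+1 = n.+1%:R * x n].
Proof.
move=> /cesaro_eigen_recurrence[x0 xS] xneq0.
case: (ex_minnP xneq0) => m xm mmin.
have lm : l * m.+1%:R = 1.
  apply/eqP; rewrite -subr_eq0.
  suff /eqP : (l * m.+1%:R - 1) * x m = 0 by rewrite mulf_eq0 (negbTE xm) orbF.
  case: m xm mmin => [|m] _ mmin; first by rewrite mulr1.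
  rewrite xS; have [->|/mmin] := eqVneq (x m) 0; first by rewrite mulr0.
  by rewrite ltnn.
exists m; split => //.
  have m0 : m.+1%:R != 0 :> R[i] by rewrite pnatr_eq0.
  by apply: (mulIf m0); rewrite lm mulVf.
move=> n mn; have /(congr1 ( *%R m.+1%:R)) := xS n.
have ml : m.+1%:R * l = 1 by rewrite mulrC.
by rewrite !mulrA mulrBr mulr1 !mulrA ml !mul1r -natrB ?ltnS ?leqW// subSS.
Qed.

(** For l = 1 / (m + 1) with m > 0 the recurrence multiplies |x_n| by
    (n + 1) / (n + 1 - m), which is at least (n + 1) / n, so that |x_n| / n
    does not decrease. *)
Lemma cesaro_eigenvector_growth (R : realType) (x : nat -> R[i]) (l : R[i]) :
  (forall n, cesaro_seq x n = l * x n) -> (exists n, x n != 0) -> l != 1 ->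
  exists (m : nat) (c : R), 0 < c /\
    forall n, (m <= n)%N -> n%:R * c <= rnorm (x n).
Proof.
move=> xl xneq0 l1.
have [m [xm lE xS]] := cesaro_eigenvalue xl xneq0.
have m0 : (0 < m)%N.
  by case: m lE {xm xS} => // lE; rewrite lE invr1 eqxx in l1.
have m0R : 0 < m%:R :> R by rewrite ltr0n.
exists m, (rnorm (x m) / m%:R); split.
  by rewrite divr_gt0// lt_neqAle rnorm_ge0 eq_sym rnorm_eq0 xm.
move=> n /subnKC <-; elim: (n - m)%N => [|{}n IH].
  by rewrite addn0 mulrC mulfVK// gt_eqF.
rewrite addnS; move: IH; set N := (m + n)%N => IH.
have N0 : 0 < N%:R :> R by rewrite ltr0n addn_gt0 m0.
have /(congr1 (@rnorm _ _)) := xS N (leq_addr _ _).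
rewrite !rnormM !rnorm_natr => NE.
rewrite -(ler_pM2l N0) (@le_trans _ _ (N.+1%:R * rnorm (x N)))//.
  by rewrite mulrCA ler_pM2l.
rewrite -NE ler_wpM2r ?rnorm_ge0// ler_nat.
by case: (m) m0 => // k _; rewrite subSS leq_subr.
Qed.

Lemma bin_le_expn n m : ('C(n, m) <= n ^ m)%N.
Proof.
elim: m n => [|m IH] [|n]; rewrite ?bin0 ?expn0 ?bin0n//.
rewrite (@leq_trans (m.+1 * 'C(n.+1, m.+1)))//; first by rewrite leq_pmull.
rewrite -mul_bin_diag expnS leq_mul2l/= (leq_trans (IH n))//.
by case: m {IH} => // m; rewrite leq_exp2r.
Qed.

(** The reason why binomial coefficients are eigenvectors: their partial sums
    are binomial coefficients again. *)
Lemma hockey_stick n m : (\sum_(i < n.+1) 'C(i, m) = 'C(n.+1, m.+1))%N.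
Proof.
elim: n => [|n IH]; first by rewrite big_ord1 binS [X in (X + _)%N]bin0n.
by rewrite big_ord_recr/= IH -binS.
Qed.

Lemma cesaro_binomial (R : realType) m n :
  cesaro_seq (fun i => ('C(i, m))%:R : R[i]) n = m.+1%:R^-1 * ('C(n, m))%:R.
Proof.
rewrite /cesaro_seq -natr_sum hockey_stick.
have m0 : m.+1%:R != 0 :> R[i] by rewrite pnatr_eq0.
have n0 : n.+1%:R != 0 :> R[i] by rewrite pnatr_eq0.
apply: (mulfI m0); rewrite mulVKf// mulrA -natrM -mul_bin_diag natrM.
by rewrite mulrAC mulfV// mul1r.
Qed.

Section spectrum.
Context {R : realType} (alpha : nat -> R).
Hypothesis alphaP : increases_to_infinity alpha.

Local Notation w := (weight alpha).
Local Notation L := (Lambda0 alpha).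

Lemma Lambda0_neq0 (x : L) : x != 0 -> exists n, Lambda0_val x n != 0.
Proof.
apply: contra_neqP => /forallNP x0; apply: val_inj; apply/funext => n /=.
by apply/eqP/negPn/negP; exact: x0.
Qed.

Lemma cesaro_opP (x : L) (l : R[i]) : cesaro_op alphaP x = l *: x ->
  forall n, cesaro_seq (Lambda0_val x) n = l * Lambda0_val x n.
Proof. by move=> xl n; have /(congr1 (fun y : L => Lambda0_val y n)) := xl. Qed.

Lemma cesaro_point_spectrum_sub :
  point_spectrum (cesaro_op alphaP) `<=` Sigma R.
Proof.
move=> l /point_spectrumP[x /Lambda0_neq0 x0 /cesaro_opP xl].
by have [m [_ -> _]] := cesaro_eigenvalue xl x0; exists m.+1.
Qed.

(** An eigenvector for an eigenvalue other than 1 grows at least linearly, so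
    its membership in the space bounds n w_k(n) for every k. *)
Lemma point_spectrum_weight_growth :
  point_spectrum (cesaro_op alphaP) `\ 1 !=set0 ->
  forall k, exists B : R, forall n, n.+1%:R * w k n <= B.
Proof.
move=> [l [/point_spectrumP[x /Lambda0_neq0 x0 /cesaro_opP xl] /= /eqP l1]] k.
have [m [c [c0 xc]]] := cesaro_eigenvector_growth xl x0 l1.
have S0 : 0 <= 2 * (Lambda0_norm k x / c).
  rewrite mulr_ge0// divr_ge0 ?(ltW c0)//.
  exact: (seminorm_ge0 (Lambda0_seminorm alpha k)).
exists (m.+1%:R + 2 * (Lambda0_norm k x / c)) => n.
have [nm|mn] := ltnP n m.+1.
  rewrite (@le_trans _ _ m.+1%:R) ?lerDl//.
  rewrite -[leRHS]mulr1 ler_pM ?ler_nat ?weight_le1//.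
  by rewrite ltW// weight_gt0.
rewrite (@le_trans _ _ (2 * (Lambda0_norm k x / c))) ?lerDr//.
rewrite mulrA ler_pdivlMr//.
rewrite (@le_trans _ _ (2 * (w k n * rnorm (Lambda0_val x n))))//; last first.
  by rewrite ler_pM2l//; exact: Lambda0_norm_ub.
rewrite mulrAC [leRHS]mulrCA mulrC ler_pM2l ?weight_gt0//.
rewrite (@le_trans _ _ (2 * (n%:R * c)))//; last by rewrite ler_pM2l// xc// ltnW.
rewrite mulrA ler_pM2r// -natrM ler_nat.
by rewrite mul2n -addnn -addn1 leq_add2l (leq_ltn_trans _ mn).
Qed.

Lemma binomial_Lambda0 m :
  (fun n => ln n.+1%:R / alpha n) @ \oo --> (0 : R) ->
  (fun n => ('C(n, m))%:R : R[i]) \in Lambda0_pred alpha.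
Proof.
move=> lna; apply/asboolP => k.
apply: (@squeeze_cvgr _ _ _ _ (cst 0) (fun n => n.+1%:R ^+ m * w k n)).
- near=> n; have w0 := ltW (weight_gt0 alpha k n).
  rewrite rnorm_natr mulr_ge0//= mulrC ler_wpM2r// -natrX ler_nat.
  rewrite (leq_trans (bin_le_expn _ _))//.
  by case: (m) => // j; rewrite leq_exp2r.
- exact: cvg_cst.
- exact: power_weight_cvg0.
Unshelve. all: by end_near. Qed.

Lemma cesaro_point_spectrum :
  (fun n => ln n.+1%:R / alpha n) @ \oo --> (0 : R) ->
  point_spectrum (cesaro_op alphaP) = Sigma R.
Proof.
move=> lna; apply/seteqP; split; first exact: cesaro_point_spectrum_sub.
move=> _ [[|m] [// _ ->]]; apply/point_spectrumP.
exists (MkLambda0_seq (@binomial_Lambda0 m lna) : L).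
  apply/eqP => /(congr1 (fun y : L => Lambda0_val y m)).
  by rewrite -[RHS]/(0 : R[i]) /= binn => /eqP; rewrite oner_eq0.
by apply: val_inj; apply/funext => n; exact: cesaro_binomial.
Qed.

End spectrum.

(** * The equivalence *)

Theorem proposition2p8 (R : realType) (alpha : nat -> R)
    (alphaP : increases_to_infinity alpha) :
  [<-> nuclear_space (Lambda0 alpha);
       (fun n : nat => ln n.+1%:R / alpha n) @ \oo --> (0 : R);
       point_spectrum (cesaro_op alphaP) = Sigma R;
       point_spectrum (cesaro_op alphaP) `\ 1 !=set0].
Proof.
tfae.
- by move=> nuc; apply: log_negligible => //; exact: nuclear_weight_growth.
- exact: cesaro_point_spectrum.
- move=> ->; exists 2%:R^-1; split; first by exists 2%N.
  by apply/eqP; rewrite invr_eq1 pnatr_eq1.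
- move=> /point_spectrum_weight_growth wB.
  by apply: log_nuclear => //; exact: log_negligible.
Qed.
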